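(* Let $1\to H \xrightarrow{i} G \xrightarrow{p} K\to 1$ be a short exact sequence of groups with $K$ finite and $H$ finitely generated, $i$ being regarded as an inclusion. Let $\nu:K\to G$ be a left transversal for $H$ with $\nu(1_K)=1_G$. Then, identifying $\mathrm{Hom}(G,\mathbb{R})$ with the subspace $Fix\,\hat\nu\subseteq \mathrm{Hom}(H,\mathbb{R})$ by restriction of characters to $H$, $$\Sigma^1(G)=\partial_\infty Fix\,\hat\nu\,\cap\,\Sigma^1(H).$$
   Context: A left transversal for $H$ is an injective function $\nu:K\to G$ with $p(\nu(k))=k$ for all $k\in K$. Set $Fix\,\hat\nu=\{\phi\in\mathrm{Hom}(H,\mathbb{R}) : \phi(\nu(k)h\nu(k)^{-1})=\phi(h)\ \text{for all } h\in H,\ k\in K\}$, a vector subspace of $\mathrm{Hom}(H,\mathbb{R})$. When $K$ is finite, restriction $\chi\mapsto\chi|_H$ is an isomorphism from $\mathrm{Hom}(G,\mathbb{R})$ onto $Fix\,\hat\nu$, and $\mathrm{Hom}(G,\mathbb{R})$ is identified with $Fix\,\hat\nu$ in this way. For a finitely generated group $G$, the character sphere is $S(G)=\{[\chi] : \chi\in \mathrm{Hom}(G,\mathbb{R})\setminus\{0\}\}$, where $[\chi_1]=[\chi_2]$ iff $\chi_1=r\chi_2$ for some $r>0$; it is also written $\partial_\infty\mathrm{Hom}(G,\mathbb{R})$. For a subspace $V\subseteq\mathrm{Hom}(H,\mathbb{R})$, $\partial_\infty V=\{[\phi]:\phi\in V\setminus\{0\}\}\subseteq S(H)$. The Bieri–Neumann–Strebel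 invariant $\Sigma^1(G)\subseteq S(G)$: let $\Gamma$ be the Cayley graph of $G$ with respect to a finite generating set (vertices $g\in G$, edges joining $g$ to $ga$ for generators $a$). Then $[\chi]\in\Sigma^1(G)$ iff the full subgraph of $\Gamma$ spanned by the vertices $g$ with $\chi(g)\ge 0$ is path connected. This does not depend on the finite generating set. *)

(* Defs.v *)
From HB Require Import structures.
From mathcomp Require Import all_boot all_order all_algebra fingroup.
From mathcomp Require Import all_classical reals.

Set Implicit Arguments.
Unset Strict Implicit.
Unset Printing Implicit Defensive.

Import Order.TTheory GRing.Theory Num.Theory.

Local Open Scope classical_set_scope.
Local Open Scope ring_scope.

Section Generation.
Variable G : groupType.

(* The only subgroup of G containing A is G itself. *)
Definition generates (A : seq G) : Prop :=
  forall S : {pred G}, group_closed S -> {subset A <= S} -> forall g, g \in S.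

Definition finitely_generated : Prop := exists A : seq G, generates A.

(* Adjacency in the (unoriented) Cayley graph. *)
Definition cayley (A : seq G) : rel G :=
  [rel g h | has (fun a => h == g * a)%g A || has (fun a => g == h * a)%g A].

End Generation.

Section Characters.
Variables (R : realType) (G : groupType).

(* Hom(G, R), as a set of functions G -> R. *)
Definition Hom : set (G -> R) :=
  [set chi | forall x y : G, chi (x * y)%g = chi x + chi y].

(* [chi], as the set of positive multiples of chi. *)
Definition ray (chi : G -> R) : set (G -> R) :=
  [set psi : G -> R | exists2 r : R, 0 < r & psi = (fun g => r * chi g)].

(* The rays of V; boundary Hom is the character sphere S(G). *)
Definition boundary (V : set (G -> R)) : set (set (G -> R)) :=
  [set ray chi | chi in V `\ 0].

(* Adjacency in the full subgraph spanned by the vertices with chi >= 0. *)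
Definition halfspace (A : seq G) (chi : G -> R) : rel G :=
  [rel g h | [&& 0 <= chi g, 0 <= chi h & cayley A g h]].

Definition halfspace_connected (A : seq G) (chi : G -> R) : Prop :=
  forall g h : G, 0 <= chi g -> 0 <= chi h ->
    exists s : seq G, path (halfspace A chi) g s /\ last g s = h.

(* See [halfspace_connected_indep] for the independence of A. *)
Definition Sigma1 : set (set (G -> R)) :=
  boundary [set chi | Hom chi /\
    exists A : seq G, generates A /\ halfspace_connected A chi].

End Characters.

Arguments Sigma1 R G : clear implicits.

Definition short_exact (H G K : groupType)
    (i : UMagmaMorphism.type H G) (p : UMagmaMorphism.type G K) : Prop :=
  [/\ injective i, range i = p @^-1` [set 1%g] & range p = [set: K]].

Definition left_transversal (G K : groupType) (p : UMagmaMorphism.type G K)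
    (nu : K -> G) : Prop :=
  injective nu /\ (forall k, p (nu k) = k).

(* When i identifies H with a normal subgroup of G, the element h' below is the
   conjugate nu(k) h nu(k)^-1, and it exists and is unique. *)
Definition Fix_hat (R : realType) (H G K : groupType) (i : UMagmaMorphism.type H G)
    (nu : K -> G) : set (H -> R) :=
  [set phi | Hom phi /\
    forall (h h' : H) (k : K),
      i h' = (nu k * i h * (nu k)^-1)%g -> phi h' = phi h].

Arguments Fix_hat R {H G K} i nu.

(* The map S(G) -> S(H) induced by restriction of characters: it sends [chi]
   to [chi \o i] (see [res_sphere_ray]); it is injective when K is finite, as
   restriction of characters then is (see [comp_inj]). *)
Definition res_sphere (R : realType) (H G : groupType)
    (i : UMagmaMorphism.type H G) (c : set (G -> R)) : set (H -> R) :=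
  [set chi \o i | chi in c].

Lemma res_sphere_ray (R : realType) (H G : groupType)
  (i : UMagmaMorphism.type H G) (chi : G -> R) :
  res_sphere i (ray chi) = ray (chi \o i).
Proof.
apply/seteqP; split=> [_ [_ [r r0 ->] <-]|_ [r r0 ->]]; first by exists r.
by exists (fun g => r * chi g) => //; exists r.
Qed.

Lemma comp_inj (R : realType) (H G : groupType) (K : finGroupType)
  (i : UMagmaMorphism.type H G) (p : UMagmaMorphism.type G K) :
  short_exact i p -> {in Hom (R := R) (G := G) &, injective (fun chi => chi \o i)}.
Proof.
move=> [_ ker_p _] chi psi; rewrite !inE => chiH psiH E; apply/funext => g.
have pos (f : G -> R) : Hom f -> forall n, f (g ^+ n.+1)%g = f g *+ n.+1.
  move=> fH; elim=> [|n IH]; first by rewrite expg1.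
  by rewrite expgS fH IH [RHS]mulrS.
have [n nE] : exists n, #|K| = n.+1.
  by exists #|K|.-1; rewrite prednK// -cardsT (cardG_gt0 [set: K]%G).
have : range i (g ^+ n.+1)%g.
  rewrite ker_p -nE /= gmulfXn -cardsT.
  have /dvdnP[m ->] := cardSg (finset.subsetT <[p g]>%g).
  by rewrite mulnC expgM expg_order expg1n.
move=> [h _ hE]; have := congr1 (fun f => f h) E.
by rewrite /= hE !pos// => /eqP; rewrite eqr_pMn2r// => /eqP.
Qed.

Section Independence.
Variables (R : realType) (G : groupType) (chi : G -> R).
Hypothesis chiH : Hom chi.

Let chiM x y : chi (x * y)%g = chi x + chi y. Proof. exact: chiH. Qed.

Let chi1 : chi 1%g = 0.
Proof. by apply: (addIr (chi 1%g)); rewrite -chiM mulg1 add0r. Qed.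

Let chiV x : chi x^-1%g = - chi x.
Proof. by apply/eqP; rewrite -addr_eq0 -chiM mulVg chi1. Qed.

Let chiX x n : chi (x ^+ n)%g = chi x *+ n.
Proof.
by elim: n => [|n IH]; rewrite ?expg0 ?chi1// expgS chiM IH mulrS.
Qed.

(* y can be reached from x inside the half-space chi >= c. *)
Definition joined (B : seq G) (c : R) (x y : G) : Prop :=
  exists s : seq G, path (cayley B) x s /\ last x s = y /\
    all (fun g => c <= chi g) (x :: s).

Let joined_trans B c x y z : joined B c x y -> joined B c y z -> joined B c x z.
Proof.
move=> [s [ps [ls /= /andP[cx al]]]] [t [pt [lt /= /andP[_ al']]]].
exists (s ++ t); split; first by rewrite cat_path ps ls.
by split; rewrite ?last_cat ?ls//= cx all_cat al.
Qed.

Let cayleyC (B : seq G) x y : cayley B x y = cayley B y x.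
Proof. by rewrite /cayley /= orbC. Qed.

Let joined1 (B : seq G) c x y : cayley B x y -> c <= chi x -> c <= chi y -> joined B c x y.
Proof. by move=> xy cx cy; exists [:: y]; rewrite /= xy cx cy. Qed.

Let joined_sym B c x y : joined B c x y -> joined B c y x.
Proof.
move=> [s []]; elim: s x => [|z s IH] x /=.
  by move=> _ [-> /andP[cy _]]; exists [::]; rewrite /= cy.
move=> /andP[xz pz] [ly /and3P[cx cz al]].
apply: (joined_trans (IH _ pz _)); first by split => //=; rewrite cz.
by apply: joined1 => //; rewrite cayleyC.
Qed.

Let joinedW B c c' x y : c' <= c -> joined B c x y -> joined B c' x y.
Proof.
move=> cc [s [ps [ls al]]]; exists s; split => //; split => //.
by apply: sub_all al => g; apply: le_trans.
Qed.

Let cayleyM (B : seq G) t x y : cayley B (t * x)%g (t * y)%g = cayley B x y.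
Proof.
by rewrite /cayley /=; congr (_ || _); apply: eq_has => a;
  rewrite -mulgA; apply: (inj_eq (mulgI t)).
Qed.

Let joinedM B c t x y :
  joined B c x y -> joined B (chi t + c) (t * x)%g (t * y)%g.
Proof.
move=> [s [ps [ls al]]]; exists (map (mulg t) s); split.
  by rewrite path_map; apply: sub_path ps => u v /=; rewrite cayleyM.
split; first by rewrite last_map ls.
rewrite -(map_cons (mulg t)) all_map; apply: sub_all al => g /=.
by rewrite chiM lerD2l.
Qed.

Let joined_ex (B : seq G) : generates B -> forall g, exists c, joined B c 1%g g.
Proof.
move=> gB g.
have J1 : exists c, joined B c 1%g 1%g by exists 0, [::]; rewrite /= chi1 lexx.
pose S : {pred G} := [pred g | `[< exists c, joined B c 1%g g >]].
suff : g \in S by move/asboolP.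
apply: gB => [|b bB].
  split=> [|x y /asboolP[c1 j1] /asboolP[c2 j2]]; first exact/asboolP.
  apply/asboolP; exists (Num.min c1 (chi (x / y)%g + c2)).
  apply: (@joined_trans _ _ _ x); first by apply: joinedW j1; rewrite ge_min lexx.
  apply: joined_sym; have := joinedM (x / y)%g j2.
  rewrite mulg1 mulgVK => j3; apply: joinedW j3; by rewrite ge_min lexx orbT.
apply/asboolP; exists (Num.min 0 (chi b)); apply: joined1.
- rewrite /cayley /=; apply/orP; left; apply/hasP; exists b => //.
  by rewrite mul1g.
- by rewrite chi1 ge_min lexx.
- by rewrite ge_min lexx orbT.
Qed.

Let joined_unif (A B : seq G) : generates B ->
  exists c, forall a, a \in A -> joined B c 1%g a.
Proof.
move=> gB; elim: A => [|a A [c IH]]; first by exists 0.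
have [c' j] := joined_ex gB a; exists (Num.min c c') => b.
rewrite inE => /orP[/eqP->|bA].
  by apply: joinedW j; rewrite ge_min lexx orbT.
by apply: joinedW (IH _ bA); rewrite ge_min lexx.
Qed.

Let halfspaceP (B : seq G) x y : 0 <= chi x ->
  (exists s, path (halfspace B chi) x s /\ last x s = y) <-> joined B 0 x y.
Proof.
move=> x0; split=> [[s]|[s]].
  elim: s x x0 => [|z s IH] x x0 /= [].
    by move=> _ <-; exists [::]; rewrite /= x0.
  move=> /andP[/and3P[_ z0 xz] pz] lz.
  exact: joined_trans (joined1 xz x0 z0) (IH _ z0 (conj pz lz)).
elim: s x x0 => [|z s IH] x x0 /= [].
  by move=> _ [<- _]; exists [::].
move=> /andP[xz pz] [lz /and3P[_ z0 al]].
have [|t [pt lt]] := IH z z0; first by split => //=; rewrite z0.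
by exists (z :: t) => /=; split => //; rewrite /halfspace /= x0 z0 xz.
Qed.

Let ex_pos (B : seq G) : generates B -> chi <> 0 ->
  exists t, 0 < chi t /\ cayley B 1%g t.
Proof.
move=> gB chi0; apply: contrapT => nt; apply: chi0; apply/funext => g /=.
pose S : {pred G} := [pred g | chi g == 0].
suff : g \in S by move/eqP.
apply: gB => [|b bB].
  split=> [|x y /eqP cx /eqP cy]; first by apply/eqP; rewrite chi1.
  by apply/eqP; rewrite chiM chiV cx cy subr0.
apply/negPn/negP; rewrite /= => b0; apply: nt.
have [b1|b1|b1] := ltgtP (chi b) 0; last by rewrite inE /= b1 eqxx in b0.
  exists b^-1%g; split; first by rewrite chiV oppr_gt0.
  rewrite /cayley /=; apply/orP; right; apply/hasP; exists b => //.
  by rewrite mulVg.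
exists b; split => //; rewrite /cayley /=; apply/orP; left; apply/hasP.
by exists b => //; rewrite mul1g.
Qed.

Let joined_pow (B : seq G) t n x : cayley B 1%g t -> 0 < chi t -> 0 <= chi x ->
  joined B 0 x (x * t ^+ n)%g.
Proof.
move=> ct t0 x0; elim: n => [|n IH].
  by rewrite expg0 mulg1; exists [::]; rewrite /= x0.
have xn m : 0 <= chi (x * t ^+ m)%g.
  by rewrite chiM chiX addr_ge0// mulrn_wge0// ltW.
apply: joined_trans IH _; apply: joined1 => //.
by rewrite expgSr mulgA -[X in cayley _ X _]mulg1 cayleyM.
Qed.

Lemma halfspace_connected_indep (A B : seq G) :
  generates A -> generates B -> chi <> 0 ->
  halfspace_connected A chi -> halfspace_connected B chi.
Proof.
move=> gA gB chi0 cA.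
have [t [t0 ct]] := ex_pos gB chi0.
have [c jc] := joined_unif A gB.
pose n := Num.bound `|- c / chi t|.
have nc : 0 <= chi (t ^+ n)%g + c.
  rewrite chiX -[c]opprK subr_ge0 -mulr_natl -ler_pdivrMr//.
  by rewrite (le_trans (ler_norm _))// ltW// archi_boundP.
have sub x y : joined A 0 x y -> joined B c x y \/ x = y.
  move=> [s []]; elim: s x => [|z s IH] x /=; first by move=> _ [-> _]; right.
  move=> /andP[xz pz] [lz /and3P[x0 z0 al]]; left.
  have j1 : joined B c x z.
    case/orP: xz => /hasP[a aA /eqP E].
      have := joinedM x (jc _ aA); rewrite mulg1 -E.
      by apply: joinedW; rewrite lerDr.
    have := joinedM z (jc _ aA); rewrite mulg1 -E => j.
    by apply: joined_sym; apply: joinedW j; rewrite lerDr.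
  have [|j2|<- //] := IH z pz; first by split => //=; rewrite z0.
  exact: joined_trans j1 j2.
have main y : 0 <= chi y -> joined B 0 1%g y.
  move=> y0; pose y' := ((t ^+ n)^-1 * y * t ^+ n)%g.
  have y'0 : 0 <= chi y' by rewrite !chiM chiV addrAC addNr add0r.
  have tn0 : joined B 0 1%g (t ^+ n)%g.
    by rewrite -[(t ^+ n)%g]mul1g; apply: joined_pow; rewrite ?chi1.
  have yn := joined_sym (joined_pow n ct t0 y0).
  apply: joined_trans yn; apply: joined_trans tn0 _.
  have E : (t ^+ n * y' = y * t ^+ n)%g by rewrite /y' !mulgA mulgV mul1g.
  have c1 : 0 <= chi 1%g by rewrite chi1.
  have [j|e1] := sub _ _ (proj1 (halfspaceP A y' c1) (cA _ _ c1 y'0)).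
    have := joinedM (t ^+ n)%g j; rewrite mulg1 E; exact: joinedW.
  rewrite -E -e1 mulg1; exists [::]; rewrite /= chiX.
  by rewrite mulrn_wge0// ltW.
move=> x y x0 y0; apply: (proj2 (halfspaceP B y x0)).
exact: joined_trans (joined_sym (main _ x0)) (main _ y0).
Qed.

End Independence.

(* Main.v *)
(** Let n be the order of K. In every coset of H we can choose t with chi t >= 0: if chi g < 0,
    replace g by g^-(n-1). Right multiplication by these finitely many t retracts the
    half-space of G onto that of H without decreasing chi, and moves adjacent vertices to
    vertices at bounded distance; this transports connectedness in both directions.
    A conjugation-invariant character phi of H extends to G by averaging
    phi (nu k * g * (nu (k * p g))^-1) over k in K (the transfer). *)
Require Import Defs.
From HB Require Import structures.
From mathcomp Require Import all_boot all_order all_algebra fingroup.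
From mathcomp Require Import all_classical reals.

Set Implicit Arguments.
Unset Strict Implicit.
Unset Printing Implicit Defensive.

Import Order.TTheory GRing.Theory Num.Theory.

Local Open Scope classical_set_scope.

Section HomTheory.
Local Open Scope ring_scope.
Variables (R : realType) (G : groupType) (chi : G -> R).
Hypothesis chiH : Defs.Hom chi.

Lemma Hom_mul1 : chi 1%g = 0.
Proof. by apply: (addIr (chi 1%g)); rewrite -chiH mulg1 add0r. Qed.

Lemma Hom_inv x : chi x^-1%g = - chi x.
Proof. by apply/eqP; rewrite -addr_eq0 -chiH mulVg Hom_mul1. Qed.

Lemma Hom_exp x n : chi (x ^+ n)%g = chi x *+ n.
Proof. by elim: n => [|n IH]; rewrite ?expg0 ?Hom_mul1// expgS chiH IH mulrS. Qed.

Lemma Hom_conj x y : chi (x * y * x^-1)%g = chi y.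
Proof. by rewrite !chiH Hom_inv addrAC subrr add0r. Qed.

(** The normalisation at [1] is what later makes the retraction of [G] onto [H] fix [H]
    pointwise. *)
Lemma nonneg_transversal (K : finGroupType) (p : UMagmaMorphism.type G K)
    (nu : K -> G) : cancel nu p ->
  exists t : K -> G,
    [/\ t 1%g = 1%g, cancel t p & forall k, 0 <= chi (t k)].
Proof.
move=> nuK.
have ex k : exists g : G, [/\ k = 1%g -> g = 1%g, p g = k & 0 <= chi g].
  have [->|k1] := eqVneq k 1%g; first by exists 1%g; rewrite gmulf1 Hom_mul1.
  have [c0|c0] := leP 0 (chi (nu k)).
    by exists (nu k); split => // E; rewrite E eqxx in k1.
  (* This power of the inverse still lies over [k], because [k ^+ #|K| = 1]. *)
  exists ((nu k)^-1 ^+ #|K|.-1)%g; split => [E||].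
  - by rewrite E eqxx in k1.
  - have kn : (k ^+ #|K|.-1.+1 = 1)%g.
      rewrite prednK -cardsT ?(cardG_gt0 [set: K]%G)//.
      have /dvdnP[m ->] := cardSg (finset.subsetT <[k]>%g).
      by rewrite mulnC expgM expg_order expg1n.
    rewrite gmulfXn gmulfV nuK expVgn; apply: (mulIg (k ^+ #|K|.-1)%g).
    by rewrite mulVg -expgS kn.
  - by rewrite Hom_exp Hom_inv mulrn_wge0// oppr_ge0 ltW.
have [t tP] := choice ex.
exists t; split => [|k|k]; first by have [->] := tP 1%g.
- by have [] := tP k.
- by have [] := tP k.
Qed.

End HomTheory.

Section Extension.
Variables (R : realType) (H G : groupType) (K : finGroupType).
Variables (i : UMagmaMorphism.type H G) (p : UMagmaMorphism.type G K).
Hypothesis exact_ip : short_exact i p.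

Lemma short_exact_lift g : p g = 1%g -> exists h, i h = g.
Proof.
case: exact_ip => _ E _ pg.
have : range i g by rewrite E.
by case=> h _ <-; exists h.
Qed.

Lemma short_exact_comp h : p (i h) = 1%g.
Proof.
case: exact_ip => _ E _.
have : (p @^-1` [set 1%g]) (i h) by rewrite -E; exists h.
by [].
Qed.

Lemma extend_Fix_hat (nu : K -> G) (phi : H -> R) : cancel nu p ->
  Fix_hat R i nu phi -> exists2 chi : G -> R, Defs.Hom chi & chi \o i = phi.
Proof.
move=> nuK [phiH phiF].
have ex (x : K * G) :
    exists h : H, i h = (nu x.1 * x.2 * (nu (x.1 * p x.2))^-1)%g.
  by apply: short_exact_lift; rewrite !gmulfM gmulfV !nuK mulgV.
have [f fE] := choice ex.
have i_inj : injective i by case: exact_ip.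
exists (fun g => (\sum_(k : K) phi (f (k, g))) / #|K|%:R)%R.
  move=> x y /=; rewrite -mulrDl; congr (_ / _)%R.
  (* After the shift of [k] by [p x], additivity follows termwise from the cocycle identity
     [f (k, x * y) = f (k, x) * f (k * p x, y)]. *)
  rewrite [X in (_ = _ + X)%R](reindex_inj (mulIg (p x))) -big_split /=.
  apply: eq_bigr => k _; rewrite -phiH; congr phi; apply: i_inj.
  by rewrite gmulfM !fE /= gmulfM !mulgA mulgVK.
apply/funext => h /=.
(* On [H] each summand is [phi] of a conjugate of [h], so the average is over [#|K|] equal terms. *)
rewrite (eq_bigr (fun=> phi h)) => [|k _].
  rewrite sumr_const -(mulr_natr (phi h)) mulfK// pnatr_eq0 -lt0n -cardsT.
  exact: (cardG_gt0 [set: K]%G).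
by apply: (phiF _ _ k); rewrite fE /= short_exact_comp mulg1.
Qed.

Section Connectedness.
Local Open Scope ring_scope.
Variables (chi : G -> R) (t : K -> G).
Hypotheses (chiH : Defs.Hom chi) (t1 : t 1%g = 1%g) (tK : cancel t p).
Hypothesis t_ge0 : forall k, 0 <= chi (t k).

Lemma halfspace_connected_ker (A : seq G) :
  finitely_generated H -> halfspace_connected A chi ->
  exists B : seq H, generates B /\ halfspace_connected B (chi \o i).
Proof.
move=> [A' gA'] cA.
(* The retraction is [g |-> g * u g], which lies over [1]. *)
pose u g := t (p g)^-1%g.
have ex g : exists h : H, i h = (g * u g)%g.
  by apply: short_exact_lift; rewrite gmulfM tK mulgV.
have [r rE] := choice ex.
(* With [k = (p x)^-1], this is the quotient [(r x)^-1 * r (x * a)]; it depends on [x] only through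
   its coset, so finitely many values occur. *)
have ex' (x : K * G) :
    exists h : H, i h = ((t x.1)^-1 * x.2 * t ((p x.2)^-1 * x.1))%g.
  apply: short_exact_lift.
  by rewrite !gmulfM gmulfV !tK mulgA mulgK mulVg.
have [e eE] := choice ex'.
have i_inj : injective i by case: exact_ip.
have rK h : r (i h) = h.
  by apply: i_inj; rewrite rE /u short_exact_comp invg1 t1 mulg1.
(* The part [A'] ensures generation of [H]; the elements [e (k, a)] label the edges of retracted
   paths. *)
pose C := A' ++ [seq e (k, a) | k <- enum K, a <- A].
have step x a : a \in A -> exists2 c, c \in C & r (x * a)%g = (r x * c)%g.
  move=> aA; exists (e ((p x)^-1%g, a)).
    rewrite mem_cat; apply/orP; right.
    by apply: allpairs_f => //; rewrite mem_enum.
  apply: i_inj; rewrite gmulfM !rE eE /= /u gmulfM invgM.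
  by rewrite !mulgA mulgK.
exists C; split.
  by move=> S cS CS; apply: gA' => // a aA; apply: CS; rewrite mem_cat aA.
move=> x y x0 y0; have [s [ps ls]] := cA _ _ x0 y0.
exists (map r s); split; last by rewrite -{1}[x]rK last_map ls rK.
rewrite -{1}[x]rK; apply: homo_path ps => g h /and3P[g0 h0 gh].
have r0 z : 0 <= chi z -> 0 <= (chi \o i) (r z).
  by move=> z0; rewrite /= rE chiH addr_ge0 ?t_ge0.
apply/and3P; split; [exact: r0 | exact: r0 |].
case/orP: gh => /hasP[a /step sa /eqP->]; apply/orP; [left|right]; apply/hasP.
  by have [c cC ->] := sa g; exists c.
by have [c cC ->] := sa h; exists c.
Qed.

Lemma halfspace_connected_ext (A : seq H) :
  generates A -> halfspace_connected A (chi \o i) ->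
  exists B : seq G, generates B /\ halfspace_connected B chi.
Proof.
move=> gA cA.
pose B := map i A ++ map t (enum K).
have iB a : a \in A -> i a \in B by move=> aA; rewrite mem_cat map_f.
have tB k : t k \in B by rewrite mem_cat map_f ?orbT// mem_enum.
have ex g : exists h : H, i h = (g * t (p g)^-1)%g.
  by apply: short_exact_lift; rewrite gmulfM tK mulgV.
exists B; split.
  move=> S [S1 SV] BS g; have [h hE] := ex g.
  have : h \in [pred h | i h \in S].
    apply: gA => [|a aA]; last by rewrite inE BS// iB.
    split=> [|x y xS yS]; first by rewrite inE gmulf1.
    by rewrite inE gmulfM gmulfV SV.
  rewrite inE hE => gS; rewrite -[g](mulgK (t (p g)^-1%g)).
  by apply: SV => //; apply: BS.
move=> x y x0 y0; have [hx hxE] := ex x; have [hy hyE] := ex y.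
have hx0 : 0 <= chi (i hx) by rewrite hxE chiH addr_ge0 ?t_ge0.
have hy0 : 0 <= chi (i hy) by rewrite hyE chiH addr_ge0 ?t_ge0.
have [s [ps ls]] := cA _ _ hx0 hy0.
(* One edge [t] leads from [x] into [H], the path there is mapped by [i], and one edge [t] traversed
   backwards ends at [y]. *)
exists (i hx :: rcons (map i s) y); split; last by rewrite /= last_rcons.
rewrite /= rcons_path last_map ls; apply/and3P; split.
- apply/and3P; split => //; apply/orP; left; apply/hasP.
  by exists (t (p x)^-1%g) => //; rewrite hxE.
- apply: homo_path ps => g h /and3P[g0 h0 gh]; apply/and3P; split => //.
  case/orP: gh => /hasP[a aA /eqP->]; apply/orP; [left|right];
    by apply/hasP; exists (i a); rewrite ?iB// gmulfM.
- apply/and3P; split => //; apply/orP; right; apply/hasP.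
  by exists (t (p y)^-1%g) => //; rewrite hyE.
Qed.

End Connectedness.
End Extension.

(** Since [psi] lies on its own ray, it is a positive multiple of [phi], and invariance survives
    scaling. *)
Lemma Fix_hat_ray (R : realType) (H G K : groupType)
    (i : UMagmaMorphism.type H G) (nu : K -> G) (phi psi : H -> R) :
  ray phi = ray psi -> Fix_hat R i nu phi -> Fix_hat R i nu psi.
Proof.
move=> E [phiH phiF].
have : ray psi psi.
  by exists 1%R; rewrite ?ltr01//; apply/funext => h; rewrite mul1r.
rewrite -E => -[r _ ->]; split=> [x y|h h' k /phiF->//].
by rewrite phiH mulrDr.
Qed.

Theorem theorem4p3 (R : realType) (H G : groupType) (K : finGroupType)
    (i : UMagmaMorphism.type H G) (p : UMagmaMorphism.type G K) (nu : K -> G) :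
  short_exact i p ->
  finitely_generated H ->
  left_transversal p nu ->
  nu 1%g = 1%g ->
  [set res_sphere i c | c in Sigma1 R G] = boundary (Fix_hat R i nu) `&` Sigma1 R H.
Proof.
move=> ex fgH [_ nuK] _; apply/seteqP; split.
  move=> _ [_ [chi [[chiH [A [_ cA]]] chi0] <-] <-]; rewrite res_sphere_ray.
  have resH : Defs.Hom (chi \o i) by move=> x y /=; rewrite gmulfM chiH.
  (* Finiteness of [K] enters here: a character of [G] vanishing on [H] is zero. *)
  have res0 : chi \o i <> 0%R.
    move=> E; apply: chi0; apply: (comp_inj ex); rewrite ?inE//.
    by move=> x y /=; rewrite addr0.
  have [t [t1 tK t0]] := nonneg_transversal chiH nuK.
  split; exists (chi \o i) => //; split => //.
    by split => // h h' k /= ->; rewrite Hom_conj.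
  by split => //; apply: (halfspace_connected_ker ex chiH t1 tK t0 fgH cA).
move=> _ [[psi [psiF _] <-] [phi [[phiH [A [gA cA]]] phi0] E]].
(* The two memberships give different representatives of one ray; invariance passes from [psi] to
   [phi], whose half-space is the connected one. *)
have [chi chiH chiE] := extend_Fix_hat ex nuK (Fix_hat_ray (esym E) psiF).
have [t [t1 tK t0]] := nonneg_transversal chiH nuK.
rewrite -E -chiE -res_sphere_ray; exists (ray chi) => //; exists chi => //.
split; first by split=> //; apply: (halfspace_connected_ext ex chiH tK t0 gA);
  rewrite chiE.
by move=> /= c0; apply: phi0; rewrite -chiE c0.
Qed.
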